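(* Let $n>k\ge 0$ be integers, let $\mathcal{H}_S=(\mathbb{C}^2)^{\otimes k}\otimes(\mathbb{C}^2)^{\otimes (n-k)}$, and for $0<\varepsilon<1$ let $$\Phi_\varepsilon(\rho)=(1-\varepsilon^2)\rho+\varepsilon^2\sum_{j=0}^{2^{n-k}-1}R_j\rho R_j^\dagger,\qquad R_j=I^{\otimes k}\otimes|\underline{0}\rangle\langle\underline{j}|.$$ Let $\{K_l\}_{l\in S}$, $S=\{0,1,\dots,|S|-1\}$, be any finite family of non-zero weak Kraus operators for $\Phi_\varepsilon$. Then $$|S|\ge 2^{n-k}+1.$$ Consequently, if the ancillary system consists of $s_A$ qubits and contains $|S|$ mutually orthogonal states (one for each measurement outcome $l\in S$), i.e. $2^{s_A}\ge|S|$, then $s_A\ge n-k+1$. Moreover this bound is attained: the minimum of $s_A$ over all families of non-zero weak Kraus operators $\{K_l\}_{l\in S}$ for $\Phi_\varepsilon$ and all integers $s_A$ with $2^{s_A}\ge |S|$ equals $n-k+1$.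
   Context: The vectors $|\underline{j}\rangle$, $j\in\{0,\dots,2^{n-k}-1\}$, are the standard (computational) basis vectors of $(\mathbb{C}^2)^{\otimes (n-k)}$, indexed by the integer $j$ via its binary representation; $I$ is the identity on $\mathbb{C}^2$. The space $\mathcal{H}_S$ is the primary system of an $[[n,k,d]]$ stabilizer code, written in a basis in which the first $k$ qubits carry the information and the last $n-k$ qubits are the syndrome qubits; $\Phi_\varepsilon$ is the weak error-correcting map. A finite family of operators $\{K_l\}_{l\in S}$ is a family of Kraus operators for $\Phi_\varepsilon$ if $\Phi_\varepsilon(\rho)=\sum_{l\in S}K_l\rho K_l^\dagger$ for all operators $\rho$ on $\mathcal{H}_S$. The operators $K_l=K_l(\varepsilon)$ are allowed to depend on $\varepsilon$ (with $S$ fixed), and a family is called weak if each $K_l$ has the form $K_l=c_l\,(I^{\otimes n}+O(\varepsilon))$ as $\varepsilon\to 0$, for some constant $c_l$. In a continuous-time error-correction protocol, $\Phi_\varepsilon$ is implemented by polar-decomposing each $K_l=U_{C,l}M_l$, realizing the measurement $\{M_l\}_{l\in S}$ by coupling to an ancilla of $s_A$ qubits that is then measured, and applying the unitary $U_{C,l}$ conditioned on outcome $l$. Each outcome $l\in S$ requires its own ancilla state, orthogonal to those of the other outcomes. *)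

(* Defs.v *)
From HB Require Import structures.
From mathcomp Require Import all_boot all_order all_algebra.
From mathcomp Require Import spectral complex mxtens.
From mathcomp Require Import all_classical all_reals all_analysis.

Set Implicit Arguments.
Unset Strict Implicit.
Unset Printing Implicit Defensive.

Import Order.TTheory GRing.Theory Num.Theory.
Import numFieldNormedType.Exports.

Local Open Scope classical_set_scope.
Local Open Scope ring_scope.
Local Open Scope complex_scope.
Local Open Scope sesquilinear_scope.

(* The basis vector |j> of (C^2)^{(x) m}. The space of m qubits is identified
   with C^(2^m) by iterated Kronecker products, the leftmost qubit carrying the
   most significant bit of j; ket_tens justifies this reading. *)
Definition ket (R : realType) (m j : nat) : 'cV[R[i]]_(2 ^ m) :=
  \col_(i < 2 ^ m) ((i : nat) == j)%:R.

Lemma ket_tens (R : realType) (m p i j : nat) : (j < 2 ^ p)%N ->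
  tensmx (ket R m i) (ket R p j) =
  castmx (expnD 2 m p, esym (muln1 1)) (ket R (m + p) (i * 2 ^ p + j)%N).
Proof.
move=> ltj; apply/matrixP=> a b; rewrite castmxE !mxE /= -natrM mulnb.
have p0 : (0 < 2 ^ p)%N by rewrite expn_gt0.
congr (_%:R); congr nat_of_bool; rewrite [in RHS](divn_eq a (2 ^ p)).
apply/andP/eqP => [[/eqP-> /eqP->] //|E].
have E1 := congr1 (fun x => (x %/ 2 ^ p)%N) E.
have E2 := congr1 (fun x => (x %% 2 ^ p)%N) E.
move: E1 E2; rewrite /= !modnMDl !divnMDl // modn_mod (modn_small ltj).
by rewrite (divn_small (ltn_pmod _ p0)) (divn_small ltj) !addn0 => -> ->.
Qed.

(* R_j = I^{(x) k} (x) |0><j|. *)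
Definition recovery (R : realType) (n k j : nat) :
    'M[R[i]]_(2 ^ k * 2 ^ (n - k)) :=
  tensmx (1%:M : 'M[R[i]]_(2 ^ k)) (ket R (n - k) 0 *m (ket R (n - k) j)^t*).

Definition weak_EC_map (R : realType) (n k : nat) (eps : R)
    (rho : 'M[R[i]]_(2 ^ k * 2 ^ (n - k))) : 'M[R[i]]_(2 ^ k * 2 ^ (n - k)) :=
  (1 - eps ^+ 2)%:C *: rho +
  (eps ^+ 2)%:C *: \sum_(j < 2 ^ (n - k))
     recovery R n k j *m rho *m (recovery R n k j)^t*.

Arguments weak_EC_map {R} n k eps rho.

Definition is_kraus (R : realType) (N s : nat) (Phi : 'M[R[i]]_N -> 'M[R[i]]_N)
    (K : 'I_s -> 'M[R[i]]_N) : Prop :=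
  forall rho, Phi rho = \sum_(l < s) K l *m rho *m (K l)^t*.

(* K(eps) = c (1 + O(eps)) as eps -> 0, eps > 0, with c independent of eps. *)
Definition weak_op (R : realType) (N : nat) (K : R -> 'M[R[i]]_N) : Prop :=
  exists c : R[i], exists E : R -> 'M[R[i]]_N,
    E =O_ ((0 : R)^'+) (fun eps : R => eps%:C : R[i]^o) /\
    \forall eps \near (0 : R)^'+, K eps = c *: (1%:M + E eps).

Definition nonzero_weak_kraus (R : realType) (n k s : nat)
    (K : 'I_s -> R -> 'M[R[i]]_(2 ^ k * 2 ^ (n - k))) : Prop :=
  [/\ forall eps : R, 0 < eps < 1 -> is_kraus (weak_EC_map n k eps)
        (fun l => K l eps),
      forall l, weak_op (K l)
    & forall l (eps : R), 0 < eps < 1 -> K l eps != 0].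

Arguments nonzero_weak_kraus {R} n k {s} K.

Definition has_orthogonal_states (R : realType) (sA s : nat) : Prop :=
  exists a : 'I_s -> 'cV[R[i]]_(2 ^ sA),
    forall l l', (a l)^t* *m a l' = ((l == l')%:R)%:M.

Definition is_minimum (P : nat -> Prop) (m : nat) : Prop :=
  P m /\ forall x, P x -> (m <= x)%N.

(* Main.v *)
Require Import Defs.
From mathcomp Require Import all_boot all_order all_algebra complex.
From mathcomp Require Import spectral mxtens ring lra.
From mathcomp Require Import all_classical all_reals all_analysis.

(** The operators [sqrt (1 - eps^2) I] and [eps R_j] are [2^(n-k) + 1] linearly
    independent Kraus operators of [Phi_eps]. Two Kraus families [A], [K] of one
    map have the same Gram matrix [A^T conj(A) = K^T conj(K)], where each
    operator is flattened to a row; its rank is the size of an independent family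
    and at most the size of any family. The bound is attained by mixing the
    independent family with the reflection [I - (2/N) J], [J] the all-ones
    matrix of order [N = 2^(n-k) + 1]: all its entries are nonzero because
    [N > 2], so every mixed operator has a nonzero multiple of the identity as
    its leading term. *)

Import Order.TTheory GRing.Theory Num.Theory.
Import numFieldNormedType.Exports.

Local Open Scope classical_set_scope.
Local Open Scope ring_scope.
Local Open Scope complex_scope.
Local Open Scope sesquilinear_scope.

(** * Kraus families of one map: Gram matrices and mixing *)

Lemma adjmx_sum (C : numClosedFieldType) (I : finType) (m n : nat)
    (F : I -> 'M[C]_(m, n)) : (\sum_i F i)^t* = \sum_i (F i)^t*.
Proof. by rewrite linear_sum /= map_mx_sum. Qed.

Lemma adjmxZ (C : numClosedFieldType) (m n : nat) (a : C) (A : 'M[C]_(m, n)) :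
  (a *: A)^t* = Num.conj a *: A^t*.
Proof. by rewrite linearZ /= map_mxZ. Qed.

(** On a matrix unit, each Kraus term contributes only [K l i p] times the conjugate of [K l j q].
    So the Gram matrix is the Choi matrix of [Phi] up to reindexing, and depends on [Phi] alone. *)
Lemma kraus_gram (R : realType) (N s : nat) (Phi : 'M[R[i]]_N -> 'M[R[i]]_N)
    (K : 'I_s -> 'M[R[i]]_N) (M := \matrix_(l < s) mxvec (K l)) :
  is_kraus Phi K ->
  forall i j p q : 'I_N, Phi (delta_mx p q) i j =
    (M^T *m map_mx Num.conj M) (mxvec_index i p) (mxvec_index j q).
Proof.
move=> HK i j p q; rewrite HK summxE mxE; apply: eq_bigr => l _.
rewrite !mxE !mxvecE (bigD1 q) //= big1 => [|c ncq]; last first.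
  by rewrite !mxE big1 ?mul0r // => d _; rewrite !mxE (negbTE ncq) andbF mulr0.
rewrite addr0 !mxE (bigD1 p) //= big1 => [|d ndp].
  by rewrite mxE !eqxx mulr1 addr0.
by rewrite mxE (negbTE ndp) mulr0.
Qed.

Lemma kraus_free_leq (R : realType) (N r s : nat)
    (Phi : 'M[R[i]]_N -> 'M[R[i]]_N)
    (A : 'I_r -> 'M[R[i]]_N) (K : 'I_s -> 'M[R[i]]_N) :
  is_kraus Phi A -> is_kraus Phi K ->
  row_free (\matrix_(m < r) mxvec (A m)) -> (r <= s)%N.
Proof.
set MA := \matrix_(m < r) _; pose MK := \matrix_(l < s) mxvec (K l).
move=> HA HK fA.
have E : MA^T *m map_mx Num.conj MA = MK^T *m map_mx Num.conj MK.
  apply/matrixP=> x y.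
  case/mxvec_indexP: x => i p; case/mxvec_indexP: y => j q.
  by rewrite -(kraus_gram _ _ _ _ _ HA) -(kraus_gram _ _ _ _ _ HK).
(* Conjugation keeps the rows of [MA] independent, and right multiplication by a row-free matrix
   preserves rank. *)
have <- : \rank (MA^T *m map_mx Num.conj MA) = r.
  by rewrite mxrankMfree ?row_free_map // mxrank_tr; apply/eqP.
by rewrite E (leq_trans (mxrankM_maxr _ _)) // rank_leq_row.
Qed.

(** After expansion, the cross term of [A m] and [A m'] has as coefficient an entry of [U^T] times
    conjugate [U], so only the terms with m = m' survive. *)
Lemma kraus_mix (R : realType) (N r s : nat) (Phi : 'M[R[i]]_N -> 'M[R[i]]_N)
    (A : 'I_r -> 'M[R[i]]_N) (U : 'M[R[i]]_(s, r)) :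
  U^T *m map_mx Num.conj U = 1%:M -> is_kraus Phi A ->
  is_kraus Phi (fun l => \sum_m U l m *: A m).
Proof.
move=> HU HA rho; rewrite HA.
have mixE l : (\sum_m U l m *: A m) *m rho *m (\sum_m U l m *: A m)^t* =
    \sum_m \sum_m' (U l m * Num.conj (U l m')) *: (A m *m rho *m (A m')^t*).
  rewrite !mulmx_suml; apply: eq_bigr => m _.
  rewrite adjmx_sum mulmx_sumr; apply: eq_bigr => m' _.
  by rewrite adjmxZ -!scalemxAl -scalemxAr scalerA.
rewrite (eq_bigr _ (fun l _ => mixE l)) exchange_big; apply: eq_bigr => m _ /=.
rewrite exchange_big (bigD1 m) //= [X in _ + X]big1 => [|m' nm].
  rewrite -scaler_suml addr0.
  move/matrixP/(_ m m): HU; rewrite !mxE eqxx => E.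
  rewrite -[LHS]scale1r -[1]E; congr (_ *: _).
  by apply: eq_bigr => l _; rewrite !mxE.
rewrite -scaler_suml; move/matrixP/(_ m m'): HU; rewrite !mxE eq_sym (negbTE nm).
move=> E; rewrite -[RHS](scale0r (A m *m rho *m (A m')^t*)) -[X in _ = X *: _]E.
by congr (_ *: _); apply: eq_bigr => l _; rewrite !mxE.
Qed.

(** * An independent Kraus family of [weak_EC_map] *)

Lemma recoveryE (R : realType) (n k j : nat) (a b : 'I_(2 ^ k))
    (c d : 'I_(2 ^ (n - k))) :
  recovery R n k j (mxtens_index (a, c)) (mxtens_index (b, d)) =
  (a == b)%:R * (((c : nat) == 0%N)%:R * ((d : nat) == j)%:R).
Proof.
by rewrite /recovery tensmxE !mxE big_ord1 !mxE rmorph_nat.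
Qed.

Definition indep_kraus {R : realType} (n k : nat) (eps : R)
    (m : 'I_(2 ^ (n - k)).+1) : 'M[R[i]]_(2 ^ k * 2 ^ (n - k)) :=
  oapp (fun j : 'I_(2 ^ (n - k)) => eps%:C *: recovery R n k j)
       ((Num.sqrt (1 - eps ^+ 2))%:C *: 1%:M) (unlift ord0 m).

Lemma indep_krausP (R : realType) (n k : nat) (eps : R) : 0 < eps < 1 ->
  is_kraus (weak_EC_map n k eps) (indep_kraus n k eps).
Proof.
move=> /andP[e0 e1] rho; rewrite /weak_EC_map big_ord_recl /indep_kraus.
rewrite unlift_none /= adjmxZ trmx1 map_mx1 -!scalemxAl -scalemxAr mul1mx mulmx1.
have conjR (x : R) : Num.conj x%:C = x%:C :> R[i] by exact: conjc_real.
rewrite conjR scalerA -rmorphM -expr2 sqr_sqrtr; last by nra.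
congr (_ + _); rewrite scaler_sumr; apply: eq_bigr => j _.
rewrite liftK /= adjmxZ conjR -!scalemxAl -scalemxAr scalerA.
by rewrite -rmorphM -expr2.
Qed.

Lemma sum_indep_kraus (R : realType) (n k : nat) (eps : R)
    (u : 'I_(2 ^ (n - k)).+1 -> R[i]) :
  \sum_m u m *: indep_kraus n k eps m =
  (u ord0 * (Num.sqrt (1 - eps ^+ 2))%:C) *: 1%:M +
  eps%:C *: \sum_j u (lift ord0 j) *: recovery R n k j.
Proof.
rewrite big_ord_recl /indep_kraus unlift_none /= scalerA; congr (_ + _).
rewrite scaler_sumr; apply: eq_bigr => j _.
by rewrite liftK /= !scalerA mulrC.
Qed.

Lemma syndrome_gt1 (n k : nat) : (k < n)%N -> (1 < 2 ^ (n - k))%N.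
Proof. by move=> lt_kn; rewrite -{1}(expn0 2) ltn_exp2l // subn_gt0. Qed.

(* Every [R_j] vanishes at such entries, since its range has syndrome 0. *)
Lemma sum_indep_kraus_diag (R : realType) (n k : nat) (eps : R)
    (u : 'I_(2 ^ (n - k)).+1 -> R[i])
    (a : 'I_(2 ^ k)) (c : 'I_(2 ^ (n - k))) : c != 0 :> nat ->
  (\sum_m u m *: indep_kraus n k eps m)
    (mxtens_index (a, c)) (mxtens_index (a, c)) =
  u ord0 * (Num.sqrt (1 - eps ^+ 2))%:C.
Proof.
move=> c0; rewrite sum_indep_kraus !mxE eqxx mulr1 summxE.
rewrite big1 ?mulr0 ?addr0 // => j _.
by rewrite mxE recoveryE (negbTE c0) !(mul0r, mulr0).
Qed.

Lemma sqrt1Bsqr_neq0 (R : realType) (eps : R) : 0 < eps < 1 ->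
  (Num.sqrt (1 - eps ^+ 2))%:C != 0 :> R[i].
Proof.
move=> /andP[e0 e1]; rewrite fmorph_eq0 gt_eqF // sqrtr_gt0; nra.
Qed.

Lemma indep_kraus_free (R : realType) (n k : nat) (eps : R) :
  (k < n)%N -> 0 < eps < 1 ->
  row_free (\matrix_m mxvec (indep_kraus n k eps m)).
Proof.
move=> lt_kn he; apply: inj_row_free => v Hv.
have {}Hv : \sum_m v 0 m *: indep_kraus n k eps m = 0.
  apply: (can_inj mxvecK); rewrite linear0 -Hv mulmx_sum_row linear_sum.
  by apply: eq_bigr => m _; rewrite linearZ /= rowK.
pose info0 : 'I_(2 ^ k) := Ordinal (expn_gt0 2 k).
pose synd0 : 'I_(2 ^ (n - k)) := Ordinal (expn_gt0 2 (n - k)).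
pose synd1 : 'I_(2 ^ (n - k)) := Ordinal (syndrome_gt1 _ _ lt_kn).
(* A diagonal entry with syndrome 1, which exists since k < n, sees only the identity term. *)
have v0 : v 0 ord0 = 0.
  have := sum_indep_kraus_diag R n k eps (v 0) info0 synd1 isT.
  rewrite Hv mxE => /esym/eqP; rewrite mulf_eq0 => /orP[/eqP//|].
  by rewrite (negbTE (sqrt1Bsqr_neq0 _ _ he)).
apply/rowP=> m; rewrite [RHS]mxE; case: (unliftP ord0 m) => [j ->|-> //].
move: Hv; rewrite sum_indep_kraus v0 mul0r scale0r add0r => /eqP.
rewrite scaler_eq0 fmorph_eq0; have /andP[e0 _] := he.
rewrite (gt_eqF e0) /= => /eqP /matrixP.
(* Among the recovery operators only [R_j] is nonzero at this entry, from syndrome j to syndrome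
   0. *)
move=> /(_ (mxtens_index (info0, synd0)) (mxtens_index (info0, j))).
rewrite summxE (bigD1 j) //= big1 => [|j' nj].
  by rewrite mxE recoveryE !eqxx !mulr1 addr0 mxE.
by rewrite mxE recoveryE (inj_eq val_inj) (eq_sym j) (negbTE nj) !mulr0.
Qed.

(** * The reflection used for mixing *)

Definition ones_reflection (C : numFieldType) (N : nat) : 'M[C]_N :=
  1%:M - const_mx (2 / N%:R).

Lemma ones_reflection_unitary (C : numClosedFieldType) (N : nat) :
  (ones_reflection C N)^T *m map_mx Num.conj (ones_reflection C N) = 1%:M.
Proof.
case: N => [|N]; first by rewrite [LHS]flatmx0 [RHS]flatmx0.
have N0 : N.+1%:R != 0 :> C by rewrite pnatr_eq0.
have -> : map_mx Num.conj (ones_reflection C N.+1) = ones_reflection C N.+1.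
  apply/matrixP=> i j; rewrite !mxE rmorphB rmorph_nat.
  by rewrite fmorph_div !rmorph_nat.
have -> : (ones_reflection C N.+1)^T = ones_reflection C N.+1.
  by apply/matrixP=> i j; rewrite !mxE eq_sym.
rewrite /ones_reflection mulmxBl !mulmxBr.
rewrite !mulmx1 !mul1mx.
pose J2 : 'M[C]_N.+1 := const_mx (2 / N.+1%:R).
(* The square of the all-ones matrix J is N J, and (2/N)^2 N = 2 (2/N). *)
have -> : J2 *m J2 = J2 + J2.
  apply/matrixP=> i j; rewrite !mxE.
  under eq_bigr do rewrite !mxE.
  by rewrite sumr_const card_ord -mulr_natr; field.
by apply/matrixP=> i j; rewrite !mxE; ring.
Qed.

(** The entries are 1 - 2/N on the diagonal, which vanishes only for N = 2, and -2/N elsewhere. *)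
Lemma ones_reflection_neq0 (C : numFieldType) (N : nat) (i j : 'I_N) :
  N != 2%N -> ones_reflection C N i j != 0.
Proof.
move=> N2; have N0 : N%:R != 0 :> C.
  by rewrite pnatr_eq0 -lt0n (leq_ltn_trans _ (ltn_ord i)).
rewrite !mxE subr_eq0; case: (i == j).
  apply/eqP => /(congr1 (fun x => x * N%:R)); rewrite mul1r divfK // => /eqP.
  by rewrite eqr_nat (negbTE N2).
by rewrite eq_sym mulf_neq0 ?invr_eq0 // pnatr_eq0.
Qed.

(** * Weak families and their behaviour as eps tends to 0 *)

Lemma normC_real (R : realType) (x : R) : `|x%:C| = `|x|%:C :> R[i].
Proof. by rewrite normc_def /= expr0n addr0 sqrtr_sqr. Qed.

Lemma sqrt1Bsqr_near1 (R : realType) (eps : R) : 0 < eps < 1 ->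
  `|Num.sqrt (1 - eps ^+ 2) - 1| <= eps.
Proof.
move=> /andP[e0 e1]; have h : 0 <= 1 - eps ^+ 2 by nra.
have s0 := sqrtr_ge0 (1 - eps ^+ 2); have := sqr_sqrtr h.
move: (Num.sqrt _) s0 => s s0 Es; rewrite ler_norml; nra.
Qed.

Lemma weak_op_leading (R : realType) (N : nat) (c : R[i]) (G : 'M[R[i]]_N) :
  c != 0 ->
  weak_op (fun eps : R =>
    (c * (Num.sqrt (1 - eps ^+ 2))%:C) *: 1%:M + eps%:C *: G).
Proof.
move=> c0; exists c.
(* This is E solved from c (1 + E) = K; dividing by c requires [c != 0]. *)
exists (fun eps : R => (Num.sqrt (1 - eps ^+ 2) - 1)%:C *: 1%:M +
                   eps%:C *: (c^-1 *: G)).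
split; last first.
  near=> eps; rewrite !scalerDr !scalerA addrA.
  rewrite [c * _ * c^-1]mulrAC mulfV // mul1r; congr (_ + _).
  by rewrite -scalerDl rmorphB rmorph1; congr (_ *: _); ring.
(* Both coefficients in E are at most eps in modulus; the final + 1 makes the constant strictly
   positive. *)
apply/eqO_exP; exists (`|1%:M : 'M[R[i]]_N| + `|c^-1 *: G| + 1).
  by rewrite ltr_wpDl // addr_ge0.
near=> eps.
have he : 0 < eps < 1.
  by apply/andP; split; near: eps; [exact: nbhs_right_gt|exact: nbhs_right_lt].
have /andP[e0 _] := he.
rewrite (le_trans (ler_normD _ _)) // !normrZ !normC_real (ger0_norm (ltW e0)).
rewrite !mulrDl mul1r ler_wpDr ?lecR ?(ltW e0) // lerD // mulrC.
  by rewrite ler_wpM2l // lecR sqrt1Bsqr_near1.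
Unshelve. all: by end_near.
Qed.

(** The unmixed family is not weak: eps [R_j] tends to 0 without vanishing, so no constant c fits.
    Mixing gives every operator the nonzero leading coefficient [U l ord0]. *)
Lemma weak_kraus_exists (R : realType) (n k : nat) : (k < n)%N ->
  exists K : 'I_(2 ^ (n - k)).+1 -> R -> 'M[R[i]]_(2 ^ k * 2 ^ (n - k)),
    nonzero_weak_kraus n k K.
Proof.
move=> lt_kn; pose U := ones_reflection R[i] (2 ^ (n - k)).+1.
have U0 l m : U l m != 0.
  by apply: ones_reflection_neq0; rewrite eqSS gtn_eqF // syndrome_gt1.
exists (fun l eps => \sum_m U l m *: indep_kraus n k eps m); split.
- move=> eps he; apply: kraus_mix (indep_krausP _ _ _ _ he).
  exact: ones_reflection_unitary.
- move=> l; rewrite (_ : (fun eps => _) = fun eps : R =>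
      (U l ord0 * (Num.sqrt (1 - eps ^+ 2))%:C) *: 1%:M +
      eps%:C *: \sum_j U l (lift ord0 j) *: recovery R n k j).
    exact: weak_op_leading.
  by apply/funext => eps; rewrite sum_indep_kraus.
- move=> l eps he; apply/eqP => K0.
  have := sum_indep_kraus_diag R n k eps (U l) (Ordinal (expn_gt0 2 k))
            (Ordinal (syndrome_gt1 _ _ lt_kn)) isT.
  rewrite K0 mxE => /esym/eqP.
  by rewrite mulf_eq0 (negbTE (U0 _ _)) (negbTE (sqrt1Bsqr_neq0 _ _ he)).
Qed.

(** * Bounds on the family and on the ancilla *)

Lemma weak_kraus_size (R : realType) (n k s : nat)
    (K : 'I_s -> R -> 'M[R[i]]_(2 ^ k * 2 ^ (n - k))) : (k < n)%N ->
  nonzero_weak_kraus n k K -> (2 ^ (n - k) < s)%N.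
Proof.
move=> lt_kn [HK _ _].
(* The size s does not depend on eps, so it can be bounded at a single value, here 1/2. *)
have he : 0 < (2^-1 : R) < 1 by apply/andP; split; lra.
exact: kraus_free_leq _ _ _ _ _ _ _ (indep_krausP _ _ _ _ he) (HK _ he)
         (indep_kraus_free _ _ _ _ lt_kn he).
Qed.

(** Orthonormal states form the columns of an isometry, whose rank s is at most the dimension
    [2 ^ sA]; conversely, computational basis vectors serve as the states. *)
Lemma has_orthogonal_statesP (R : realType) (sA s : nat) :
  has_orthogonal_states R sA s <-> (s <= 2 ^ sA)%N.
Proof.
split=> [[a Ha]|le_s].
  pose V : 'M[R[i]]_(2 ^ sA, s) := \matrix_(i, l) a l i 0.
  have VV : V^t* *m V = 1%:M.
    apply/matrixP=> l l'; have /matrixP/(_ 0 0) := Ha l l'.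
    rewrite !mxE mulr1n => <-; apply: eq_bigr => i _.
    by rewrite !mxE.
  by rewrite -(mxrank1 R[i] s) -VV (leq_trans (mxrankM_maxr _ _)) // rank_leq_row.
exists (fun l => ket R sA l) => l l'; apply/matrixP=> i j.
rewrite !ord1 !mxE mulr1n (bigD1 (widen_ord le_s l)) //= big1 => [|d nd].
  by rewrite !mxE /= eqxx rmorph1 mul1r addr0.
rewrite !mxE; move: nd; rewrite -(inj_eq val_inj) /= => /negbTE ->.
by rewrite rmorph0 mul0r.
Qed.

Theorem mainTheorem1 (R : realType) (n k : nat) (lt_kn : (k < n)%N) :
  (forall (s : nat) (K : 'I_s -> R -> 'M[R[i]]_(2 ^ k * 2 ^ (n - k))),
      nonzero_weak_kraus n k K ->
      (2 ^ (n - k) + 1 <= s)%N /\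
      (forall sA : nat,
          (has_orthogonal_states R sA s <-> (s <= 2 ^ sA)%N) /\
          (has_orthogonal_states R sA s -> (n - k + 1 <= sA)%N))) /\
  is_minimum
    (fun sA : nat =>
       exists (s : nat) (K : 'I_s -> R -> 'M[R[i]]_(2 ^ k * 2 ^ (n - k))),
         nonzero_weak_kraus n k K /\ (s <= 2 ^ sA)%N)
    (n - k + 1)%N.

Proof.
have ancilla s (K : 'I_s -> R -> 'M[R[i]]_(2 ^ k * 2 ^ (n - k))) sA :
    nonzero_weak_kraus n k K -> (s <= 2 ^ sA)%N -> (n - k + 1 <= sA)%N.
  (* The extra qubit comes from the strict inequality 2^(n-k) < s <= 2^sA. *)
  move=> HK le_s; rewrite addn1 -(ltn_exp2l _ _ (isT : (1 < 2)%N)).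
  exact: leq_trans (weak_kraus_size _ _ _ _ _ lt_kn HK) le_s.
split=> [s K HK|].
  split=> [|sA]; first by rewrite addn1 (weak_kraus_size _ _ _ _ _ lt_kn HK).
  split; first exact: has_orthogonal_statesP.
  by move/has_orthogonal_statesP; apply: ancilla HK.
split=> [|sA [s [K [HK le_s]]]]; last exact: ancilla HK le_s.
have [K HK] := weak_kraus_exists R n k lt_kn.
exists (2 ^ (n - k)).+1, K; split=> //.
(* Doubling 2^(n-k) leaves room for one more outcome, since 1 <= 2^(n-k). *)
by rewrite addn1 expnS mul2n -addnn -addn1 leq_add2l expn_gt0.
Qed.
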